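(* For each real $\lambda>\omega$, the Yosida approximation $\mathcal{L}_\lambda=\lambda^2(\lambda I-\mathcal{L})^{-1}-\lambda I$ of the Koopman generator $\mathcal{L}$ satisfies $$\mathcal{L}_\lambda=\lambda^2\int_0^\infty e^{-\lambda t}\mathcal{K}_t\,dt-\lambda I,$$ and $\mathcal{L}_\lambda\to\mathcal{L}$ strongly on $\operatorname{dom}(\mathcal{L})$ as $\lambda\to\infty$, i.e. $\|\mathcal{L}_\lambda h-\mathcal{L}h\|\to0$ for every $h\in\operatorname{dom}(\mathcal{L})$.
   Context: $\Omega\subseteq\mathbb{R}^d$ is a pre-compact state space and $f$ is a locally Lipschitz vector field on $\Omega$; the flow $\phi(t,x)$ of $\dot x=f(x)$ is assumed to exist and stay in $\Omega$ for all $t\ge 0$, $x\in\Omega$. $\mathcal{C}(\Omega)$ is the Banach space of real-valued continuous functions on $\Omega$ with the uniform norm $\|h\|=\sup_{x\in\Omega}|h(x)|$. The Koopman operators $\mathcal{K}_t:\mathcal{C}(\Omega)\to\mathcal{C}(\Omega)$, $\mathcal{K}_th=h\circ\phi(t,\cdot)$, $t\ge0$, form a $\mathcal{C}_0$-semigroup, and $C\ge1$, $\omega\ge0$ are constants with $\|\mathcal{K}_t\|\le Ce^{\omega t}$ for all $t\ge0$. The generator is $\mathcal{L}h=\lim_{t\downarrow0}(\mathcal{K}_th-h)/t$, with $\operatorname{dom}(\mathcal{L})$ the set of $h\in\mathcal{C}(\Omega)$ for which the limit exists in $\mathcal{C}(\Omega)$. The integral of operators is understood pointwise: $\big(\int_0^\infty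 e^{-\lambda t}\mathcal{K}_t\,dt\big)h=\int_0^\infty e^{-\lambda t}\mathcal{K}_th\,dt$. *)

(* Defs.v *)
From Stdlib Require Import Reals Lra List.
From Stdlib Require Import ClassicalEpsilon ProofIrrelevance FunctionalExtensionality PropExtensionality.
From mathcomp Require Import ssreflect ssrfun ssrbool eqtype ssrnat seq fintype bigop.
From Coquelicot Require Import Coquelicot.

Open Scope R_scope.

(* R^d as functions on 'I_d: [fct_UniformSpace] gives the product topology. *)

Definition Rvec (d : nat) : Type := 'I_d -> R.

Definition Rvec_space (d : nat) : UniformSpace :=
  fct_UniformSpace 'I_d R_UniformSpace.

Definition enorm {d : nat} (v : Rvec d) : R :=
  sqrt (\big[Rplus/0]_(i < d) (v i) ^ 2).

Definition edist {d : nat} (v w : Rvec d) : R := enorm (fun i => v i - w i).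

Definition closure_of {T : UniformSpace} (A : T -> Prop) (x : T) : Prop :=
  forall P : T -> Prop, locally x P -> exists y, P y /\ A y.

Definition compact_set {T : UniformSpace} (A : T -> Prop) : Prop :=
  forall U : (T -> Prop) -> Prop,
    (forall O, U O -> open O) ->
    (forall x, A x -> exists O, U O /\ O x) ->
    exists s : list (T -> Prop),
      (forall O, In O s -> U O) /\
      (forall x, A x -> exists O, In O s /\ O x).

Definition precompact {T : UniformSpace} (A : T -> Prop) : Prop :=
  compact_set (closure_of A).

Definition subspace_nbhs {T : UniformSpace} {D : T -> Prop}
    (x : {x : T | D x}) : ({x : T | D x} -> Prop) -> Prop :=
  subset_filter (locally (proj1_sig x)) D.

Global Instance subspace_nbhs_filter {T : UniformSpace} {D : T -> Prop}
    (x : {x : T | D x}) : Filter (subspace_nbhs x).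
Proof.
rewrite /subspace_nbhs /subset_filter; split.
- exact: filter_forall.
- by move=> P Q HP HQ; apply: filter_imp (filter_and _ _ HP HQ) => y [? ?] H; split.
- by move=> P Q PQ; apply: filter_imp => y Hy H; apply: PQ.
Qed.

(* Continuity on D is continuity for the subspace topology.  Boundedness is
   what makes the uniform norm finite; it is automatic when D is compact. *)

Record Cb (T : UniformSpace) (D : T -> Prop) : Type := mkCb {
  Cb_fun :> {x : T | D x} -> R;
  Cb_cont : forall x : {x : T | D x},
    filterlim Cb_fun (subspace_nbhs x) (locally (Cb_fun x));
  Cb_bounded : exists M : R, forall x, Rabs (Cb_fun x) <= M
}.

Arguments mkCb {T D} _ _ _.
Arguments Cb_fun {T D} _ _.
Arguments Cb_cont {T D} _ _ _ _.
Arguments Cb_bounded {T D} _.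

(* [Lub_Rbar] of the empty set is [m_infty], so the norm is 0 if D is empty. *)
Definition sup_norm {T : UniformSpace} {D : T -> Prop} (h : Cb T D) : R :=
  real (Lub_Rbar (fun r => exists x, r = Rabs (h x))).

Section CbStructure.

Variables (T : UniformSpace) (D : T -> Prop).
Implicit Types (g h k : Cb T D) (x : {x : T | D x}).

Lemma Cb_ext g h : (forall x, g x = h x) -> g = h.
Proof.
case: g h => [g gc gb] [h hc hb] /= E.
have E' : g = h by apply: functional_extensionality.
subst h; f_equal; exact: proof_irrelevance.
Qed.

Lemma Cb_plus_cont g h x :
  filterlim (fun y => g y + h y) (subspace_nbhs x) (locally (g x + h x)).
Proof.
apply: (filterlim_comp_2 _ _ Rplus (Cb_cont g x) (Cb_cont h x)).
exact: (filterlim_plus (V := R_NormedModule) (g x) (h x)).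
Qed.

Lemma Cb_scal_cont (a : R) h x :
  filterlim (fun y => a * h y) (subspace_nbhs x) (locally (a * h x)).
Proof.
exact: (filterlim_comp _ _ _ _ _ _ _ _ (Cb_cont h x)
          (filterlim_scal_r (V := R_NormedModule) a (h x))).
Qed.

Lemma Cb_const_cont (a : R) x : filterlim (fun _ => a) (subspace_nbhs x) (locally a).
Proof. exact: filterlim_const. Qed.

Lemma Cb_plus_bounded g h : exists M, forall x, Rabs (g x + h x) <= M.
Proof.
have [M HM] := Cb_bounded g; have [N HN] := Cb_bounded h.
exists (M + N) => x.
have := Rabs_triang (g x) (h x); have := HM x; have := HN x; lra.
Qed.

Lemma Cb_scal_bounded (a : R) h : exists M, forall x, Rabs (a * h x) <= M.
Proof.
have [M HM] := Cb_bounded h; exists (Rabs a * M) => x.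
by rewrite Rabs_mult; apply: Rmult_le_compat_l (HM x); apply: Rabs_pos.
Qed.

Lemma Cb_const_bounded (a : R) :
  exists M, forall x : {x : T | D x}, Rabs a <= M.
Proof. by exists (Rabs a) => x; lra. Qed.

Definition Cb_plus g h : Cb T D :=
  mkCb _ (Cb_plus_cont g h) (Cb_plus_bounded g h).
Definition Cb_scal (a : R) h : Cb T D :=
  mkCb _ (Cb_scal_cont a h) (Cb_scal_bounded a h).
Definition Cb_zero : Cb T D := mkCb _ (Cb_const_cont 0) (Cb_const_bounded 0).
Definition Cb_opp h : Cb T D := Cb_scal (-1) h.

Lemma Cb_plus_comm g h : Cb_plus g h = Cb_plus h g.
Proof. by apply: Cb_ext => x /=; ring. Qed.
Lemma Cb_plus_assoc g h k :
  Cb_plus g (Cb_plus h k) = Cb_plus (Cb_plus g h) k.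
Proof. by apply: Cb_ext => x /=; ring. Qed.
Lemma Cb_plus_zero_r g : Cb_plus g Cb_zero = g.
Proof. by apply: Cb_ext => x /=; ring. Qed.

Definition Cb_AbelianMonoid_mixin :=
  AbelianMonoid.Mixin (Cb T D) _ _ Cb_plus_comm Cb_plus_assoc Cb_plus_zero_r.
Canonical Cb_AbelianMonoid :=
  AbelianMonoid.Pack (Cb T D) Cb_AbelianMonoid_mixin (Cb T D).

Lemma Cb_plus_opp_r g : plus g (Cb_opp g) = zero.
Proof. by apply: Cb_ext => x /=; ring. Qed.

Definition Cb_AbelianGroup_mixin :=
  AbelianGroup.Mixin Cb_AbelianMonoid _ Cb_plus_opp_r.
Canonical Cb_AbelianGroup :=
  AbelianGroup.Pack (Cb T D)
    (AbelianGroup.Class _ Cb_AbelianMonoid_mixin Cb_AbelianGroup_mixin)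
    (Cb T D).

Lemma Cb_scal_assoc (a b : R) h :
  Cb_scal a (Cb_scal b h) = Cb_scal (mult a b) h.
Proof. by apply: Cb_ext => x /=; rewrite /mult /=; ring. Qed.
Lemma Cb_scal_one h : Cb_scal one h = h.
Proof. by apply: Cb_ext => x /=; rewrite /one /=; ring. Qed.
Lemma Cb_scal_distr_l (a : R) g h :
  Cb_scal a (plus g h) = plus (Cb_scal a g) (Cb_scal a h).
Proof. by apply: Cb_ext => x /=; ring. Qed.
Lemma Cb_scal_distr_r (a b : R) h :
  Cb_scal (plus a b) h = plus (Cb_scal a h) (Cb_scal b h).
Proof. by apply: Cb_ext => x /=; rewrite {1}/plus /=; ring. Qed.

Definition Cb_ModuleSpace_mixin :=
  ModuleSpace.Mixin R_Ring Cb_AbelianGroup _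
    Cb_scal_assoc Cb_scal_one Cb_scal_distr_l Cb_scal_distr_r.
Canonical Cb_ModuleSpace :=
  ModuleSpace.Pack R_Ring (Cb T D)
    (ModuleSpace.Class _ _ _ Cb_ModuleSpace_mixin) (Cb T D).

Lemma sup_norm_ub h x : Rabs (h x) <= sup_norm h.
Proof.
rewrite /sup_norm /Lub_Rbar; case: ex_lub_Rbar => l /= [ub lub].
have [M HM] := Cb_bounded h.
have := ub (Rabs (h x)) (ex_intro _ x erefl).
have : Rbar_le l M by apply: lub => _ [y ->]; exact: HM.
by case: l {ub lub}.
Qed.

Lemma sup_norm_ge0 h : 0 <= sup_norm h.
Proof.
case: (excluded_middle_informative (inhabited {x : T | D x})) => [[x]|no].
  exact: Rle_trans (Rabs_pos _) (sup_norm_ub h x).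
rewrite /sup_norm /Lub_Rbar; case: ex_lub_Rbar => l /= [_ lub].
have : Rbar_le l m_infty by apply: lub => r [y _]; case: no.
by case: l {lub} => //= *; lra.
Qed.

Lemma sup_norm_le h (M : R) :
  0 <= M -> (forall x, Rabs (h x) <= M) -> sup_norm h <= M.
Proof.
move=> M0 HM; rewrite /sup_norm /Lub_Rbar; case: ex_lub_Rbar => l /= [_ lub].
have : Rbar_le l M by apply: lub => _ [y ->]; exact: HM.
by case: l {lub}.
Qed.

Lemma sup_norm_triangle g h : sup_norm (plus g h) <= sup_norm g + sup_norm h.
Proof.
apply: sup_norm_le => [|x].
  by have := sup_norm_ge0 g; have := sup_norm_ge0 h; lra.
have := sup_norm_ub g x; have := sup_norm_ub h x.
have := Rabs_triang (g x) (h x); rewrite /=; lra.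
Qed.

Lemma sup_norm_scal (a : R) h : sup_norm (scal a h) <= Rabs a * sup_norm h.
Proof.
apply: sup_norm_le => [|x /=].
  by apply: Rmult_le_pos; [apply: Rabs_pos | apply: sup_norm_ge0].
rewrite Rabs_mult; apply: Rmult_le_compat_l (sup_norm_ub h x).
exact: Rabs_pos.
Qed.

Lemma sup_norm_eq0 h : sup_norm h = 0 -> h = zero.
Proof.
move=> h0; apply: Cb_ext => x /=.
have := sup_norm_ub h x; rewrite h0 => hx.
by have := Rabs_pos (h x) => ?; apply: Rabs_eq_0; lra.
Qed.

Definition Cb_ball g (e : R) h : Prop := sup_norm (minus h g) < e.

Lemma Cb_ball_center g (e : posreal) : Cb_ball g e g.
Proof.
rewrite /Cb_ball minus_eq_zero.
apply: Rle_lt_trans (cond_pos e); apply: sup_norm_le => [|x /=]; first lra.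
by rewrite Rabs_R0; lra.
Qed.

Lemma Cb_ball_sym g h (e : R) : Cb_ball g e h -> Cb_ball h e g.
Proof.
rewrite /Cb_ball -(opp_minus h g) => lt_e; apply: Rle_lt_trans lt_e.
apply: sup_norm_le => [|x]; first exact: sup_norm_ge0.
apply: Rle_trans (sup_norm_ub (minus h g) x); right.
rewrite -Rabs_Ropp; f_equal; rewrite /=; ring.
Qed.

Lemma Cb_ball_triangle g h k (e1 e2 : R) :
  Cb_ball g e1 h -> Cb_ball h e2 k -> Cb_ball g (e1 + e2) k.
Proof.
rewrite /Cb_ball (minus_trans h k g) => H1 H2.
apply: Rle_lt_trans (sup_norm_triangle _ _) _; lra.
Qed.

Definition Cb_UniformSpace_mixin :=
  UniformSpace.Mixin (Cb T D) Cb_zero _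
    Cb_ball_center Cb_ball_sym Cb_ball_triangle.
Canonical Cb_UniformSpace :=
  UniformSpace.Pack (Cb T D) Cb_UniformSpace_mixin (Cb T D).

Canonical Cb_NormedModuleAux :=
  NormedModuleAux.Pack R_AbsRing (Cb T D)
    (NormedModuleAux.Class R_AbsRing (Cb T D)
       (ModuleSpace.class R_AbsRing Cb_ModuleSpace) Cb_UniformSpace_mixin)
    (Cb T D).

Lemma sup_norm_ball1 g h (e : R) : sup_norm (minus h g) < e -> ball g e h.
Proof. by []. Qed.

Lemma sup_norm_ball2 g h (e : posreal) :
  ball g e h -> sup_norm (minus h g) < 1 * e.
Proof. by rewrite Rmult_1_l. Qed.

Definition Cb_NormedModule_mixin :=
  NormedModule.Mixin R_AbsRing Cb_NormedModuleAux sup_norm 1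
    sup_norm_triangle sup_norm_scal sup_norm_ball1 sup_norm_ball2 sup_norm_eq0.
Canonical Cb_NormedModule :=
  NormedModule.Pack R_AbsRing (Cb T D)
    (NormedModule.Class _ _ _ Cb_NormedModule_mixin) (Cb T D).

Lemma Cb_complete (F : (Cb T D -> Prop) -> Prop) :
  ProperFilter F -> cauchy F ->
  exists l : Cb T D, forall eps : posreal, F (ball l eps).
Proof.
move=> FF cF.
pose G : (fct_UniformSpace {x : T | D x} R_UniformSpace -> Prop) -> Prop :=
  filtermap (fun h : Cb T D => (h : {x : T | D x} -> R)) F.
have FG : ProperFilter G by apply: filtermap_proper_filter.
have cG : cauchy G.
  move=> eps; have [h Fh] := cF eps; exists (Cb_fun h).
  rewrite /G /filtermap; apply: filter_imp Fh => k hk x.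
  apply: (Rle_lt_trans _ _ _ _ hk).
  apply: Rle_trans (sup_norm_ub (minus k h) x); right.
  by congr Rabs; rewrite /minus /plus /opp /=; ring.
have Fg : forall eps : posreal,
    F (fun h => forall x, Rabs (h x - lim G x) < eps).
  move=> eps; exact: (complete_cauchy G FG cG eps).
set g := lim G in Fg.
have gc : forall x, filterlim g (subspace_nbhs x) (locally (g x)).
  move=> x; apply/filterlim_locally => eps.
  pose e3 : posreal := mkposreal (eps / 3) ltac:(have := cond_pos eps; lra).
  have [h Hh] := filter_ex _ (Fg e3).
  have /filterlim_locally/(_ e3) hx := Cb_cont h x.
  apply: filter_imp hx => y.
  rewrite /ball /= /AbsRing_ball /abs /minus /plus /opp /= => hy.
  have := Hh x; have := Hh y; move: hy; rewrite /e3 /=.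
  by do 3! (move=> /Rabs_def2 [? ?]); apply: Rabs_def1; lra.
have gb : exists M, forall x, Rabs (g x) <= M.
  have [h Hh] := filter_ex _ (Fg (mkposreal 1 Rlt_0_1)).
  have [M HM] := Cb_bounded h; exists (M + 1) => x.
  have := HM x; have := Rabs_triang_inv (g x) (h x).
  by have := Hh x; rewrite Rabs_minus_sym /=; lra.
exists (mkCb g gc gb) => eps.
pose e2 : posreal := mkposreal (eps / 2) ltac:(have := cond_pos eps; lra).
apply: filter_imp (Fg e2) => h Hh.
have e0 := cond_pos eps.
rewrite /ball /= /Cb_ball.
apply: (Rle_lt_trans _ (eps / 2)); last lra.
apply: sup_norm_le => [|x]; first lra.
left; have := Hh x; rewrite /e2 /=.
by congr (Rabs _ < _); ring.
Qed.

Definition Cb_lim (F : (Cb T D -> Prop) -> Prop) : Cb T D :=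
  epsilon (inhabits Cb_zero) (fun l => forall eps : posreal, F (ball l eps)).

Lemma Cb_lim_cauchy (F : (Cb T D -> Prop) -> Prop) :
  ProperFilter F -> cauchy F ->
  forall eps : posreal, F (ball (Cb_lim F) eps).
Proof.
move=> FF cF.
exact: (epsilon_spec (inhabits Cb_zero)
          (fun l => forall eps : posreal, F (ball l eps)) (Cb_complete F FF cF)).
Qed.

Lemma Cb_lim_close (F1 F2 : (Cb T D -> Prop) -> Prop) :
  filter_le F1 F2 -> filter_le F2 F1 -> close (Cb_lim F1) (Cb_lim F2).
Proof.
move=> H12 H21.
have -> : F1 = F2.
  apply: functional_extensionality => P.
  apply: propositional_extensionality.
  by split; [apply: H21 | apply: H12].
exact: close_refl.
Qed.

Definition Cb_CompleteSpace_mixin :=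
  CompleteSpace.Mixin Cb_UniformSpace Cb_lim Cb_lim_cauchy Cb_lim_close.
Canonical Cb_CompleteSpace :=
  CompleteSpace.Pack (Cb T D)
    (CompleteSpace.Class _ _ Cb_CompleteSpace_mixin) (Cb T D).
Canonical Cb_CompleteNormedModule :=
  CompleteNormedModule.Pack R_AbsRing (Cb T D)
    (CompleteNormedModule.Class R_AbsRing (Cb T D)
       (NormedModule.class R_AbsRing Cb_NormedModule) Cb_CompleteSpace_mixin)
    (Cb T D).

End CbStructure.

Section Semigroups.

Context {V : CompleteNormedModule R_AbsRing}.
Implicit Types (K : R -> V -> V) (lambda : R) (h g : V).

Definition op_norm (A : V -> V) : Rbar :=
  Lub_Rbar (fun r => exists h, norm h <= 1 /\ r = norm (A h)).

(* Only the values K t with 0 <= t matter. *)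
Record C0_semigroup K : Prop := {
  C0_linear : forall t, 0 <= t -> is_linear (K t);
  C0_zero : forall h, K 0 h = h;
  C0_plus : forall s t h, 0 <= s -> 0 <= t -> K (s + t) h = K s (K t h);
  C0_cont : forall h, filterlim (fun t => K t h) (at_right 0) (locally h)
}.

Definition is_generator_at K h g : Prop :=
  filterlim (fun t => scal (/ t) (minus (K t h) h)) (at_right 0) (locally g).

Definition generator_dom K h : Prop := exists g, is_generator_at K h g.

(* Meaningful on [generator_dom K] only. *)
Definition generator K h : V := iota (is_generator_at K h).

(* The inverse of lambda I - L : dom L -> V; meaningful when
   [in_resolvent_set K lambda]. *)
Definition resolvent K lambda g : V :=
  iota (fun h => generator_dom K h /\
                 minus (scal lambda h) (generator K h) = g).

Definition in_resolvent_set K lambda : Prop :=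
  is_linear (resolvent K lambda) /\
  (forall g, generator_dom K (resolvent K lambda g) /\
     minus (scal lambda (resolvent K lambda g))
           (generator K (resolvent K lambda g)) = g) /\
  (forall h, generator_dom K h ->
     resolvent K lambda (minus (scal lambda h) (generator K h)) = h).

Definition yosida K lambda h : V :=
  minus (scal (lambda ^ 2) (resolvent K lambda h)) (scal lambda h).

End Semigroups.

Section Dynamics.

Context {d : nat} {Omega : Rvec_space d -> Prop}.

Definition locally_lipschitz (f : {x | Omega x} -> Rvec d) : Prop :=
  forall x : {x | Omega x}, exists delta L : R, 0 < delta /\
    forall y z : {x | Omega x},
      edist (proj1_sig y) (proj1_sig x) < delta ->
      edist (proj1_sig z) (proj1_sig x) < delta ->
      edist (f y) (f z) <= L * edist (proj1_sig y) (proj1_sig z).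

(* The derivative is taken within [0, +oo), hence one-sided at t = 0. *)
Definition is_flow (f : {x | Omega x} -> Rvec d)
    (phi : R -> {x | Omega x} -> {x | Omega x}) : Prop :=
  (forall x, phi 0 x = x) /\
  forall (x : {x | Omega x}) (t : R) (i : 'I_d), 0 <= t ->
    filterdiff (fun s => proj1_sig (phi s x) i)
      (within (fun s => 0 <= s) (locally t))
      (fun u => scal u (f (phi t x) i)).

Definition is_koopman (phi : R -> {x | Omega x} -> {x | Omega x})
    (K : R -> Cb (Rvec_space d) Omega -> Cb (Rvec_space d) Omega) : Prop :=
  forall t h x, 0 <= t -> K t h x = h (phi t x).

End Dynamics.

(* Main.v *)
Require Import Defs.
From Stdlib Require Import Reals Lra.
From mathcomp Require Import ssreflect fintype.
From Coquelicot Require Import Coquelicot.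

Open Scope R_scope.

(** The theorem identifies the resolvent of a semigroup generator with the Laplace
    transform of the semigroup.  The argument is made for a strongly continuous
    semigroup [K] on a complete normed space with
    [norm (K t h) <= C * exp (omega * t) * norm h], and then specialised to the
    Koopman operators.

    For [lambda > omega] the integral [J h] of [exp (- lambda * t) * K t h]
    converges absolutely ([ex_laplace]).  Translating the variable of
    integration gives
    [K s (J h) = exp (lambda * s) * (J h - int_0^s exp (- lambda * t) * K t h dt)],
    and differentiating at [s = 0] shows that [J h] lies in the domain of the
    generator [L], with [L (J h) = lambda * J h - h] ([generator_laplace]).
    Conversely [J] is bounded and commutes with every [K s], so [J] applied to
    the difference quotients of [h] in the domain yields
    [J (L h) = lambda * J h - h] ([laplace_generator]).  Thus [J] is a two-sided
    inverse of [lambda - L], that is, the resolvent ([resolvent_laplace]), which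
    is the first claim.

    For [h] in the domain, the same identity turns the Yosida approximation into
    [lambda * J (L h)] ([yosida_generator]), so strong convergence reduces to
    [lambda * J g -> g] for every [g].  Since [lambda * exp (- lambda * t)] has
    integral [1], [lambda * J g - g] is the average of [K t g - g] against an
    exponential law which concentrates at [0], where the displacement
    [K t g - g] is small by strong continuity
    ([norm_scal_laplace_minus_le], [lim_yosida]). *)

(** * Vector-valued integrals *)

Lemma minus_minus_cancel {G : AbelianGroup} (x y : G) : minus x (minus x y) = y.
Proof.
by rewrite {1}/minus opp_minus /minus plus_comm -plus_assoc plus_opp_l plus_zero_r.
Qed.

(** A linear map commutes with each Riemann sum, and its continuity passes this
    to the limit. *)
Lemma is_RInt_linear {U V : NormedModule R_AbsRing} (A : U -> V) (f : R -> U)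
    (a b : R) (l : U) :
  is_linear A -> is_RInt f a b l -> is_RInt (fun t => A (f t)) a b (A l).
Proof.
move=> linA If.
have sumA ptd : Riemann_sum (fun t => A (f t)) ptd = A (Riemann_sum f ptd).
  elim/(@SF_cons_ind R): ptd => [x0|y s IHs].
    by rewrite /Riemann_sum /= linear_zero.
  by rewrite !Riemann_sum_cons IHs (linear_plus _ linA) (linear_scal _ linA).
apply: (filterlim_ext (fun ptd => A (scal (sign (b - a)) (Riemann_sum f ptd)))).
  by move=> ptd; rewrite sumA (linear_scal _ linA).
by apply: filterlim_comp If _; apply: linear_cont.
Qed.

Lemma is_RInt_gen_linear {U V : NormedModule R_AbsRing} (A : U -> V) (f : R -> U)
    (Fa Fb : (R -> Prop) -> Prop) {FFa : Filter Fa} {FFb : Filter Fb} (l : U) :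
  is_linear A -> is_RInt_gen f Fa Fb l ->
  is_RInt_gen (fun t => A (f t)) Fa Fb (A l).
Proof.
move=> linA If P locP.
have := If _ (linear_cont A l linA P locP).
rewrite /filtermapi; apply: filter_imp => ab [y [Iy Py]].
by exists (A y); split => //; apply: is_RInt_linear.
Qed.

Lemma is_RInt_gen_shift {V : NormedModule R_AbsRing} (f : R -> V) (s : R) (l : V) :
  is_RInt_gen f (at_point s) (Rbar_locally p_infty) l ->
  is_RInt_gen (fun t => f (t + s)) (at_point 0) (Rbar_locally p_infty) l.
Proof.
move=> If P locP.
have [Q W Qs [M HM] HQW] := If P locP.
apply: (Filter_prod _ _ _ (fun x => x = 0) (fun x => M - s < x)) => //.
  by exists (M - s).
move=> x y -> My.
have [||z [Iz Pz]] := HQW s (y + s); [exact: Qs | by apply: HM; lra |].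
exists z; split => //=.
apply: (is_RInt_ext (fun t => scal 1 (f (1 * t + s)))).
  by move=> t _; rewrite Rmult_1_l; apply: scal_one.
by apply: is_RInt_comp_lin; rewrite Rmult_0_r Rplus_0_l Rmult_1_l.
Qed.

Lemma is_RInt_gen_p_infty {V : NormedModule R_AbsRing} (f I : R -> V) (a : R) (l : V) :
  (forall b, a <= b -> is_RInt f a b (I b)) ->
  filterlim I (Rbar_locally p_infty) (locally l) ->
  is_RInt_gen f (at_point a) (Rbar_locally p_infty) l.
Proof.
move=> If limI P locP.
have [M HM] := limI P locP.
apply: (Filter_prod _ _ _ (fun x => x = a) (fun x => Rmax a M < x)) => //.
  by exists (Rmax a M).
move=> x y -> My; exists (I y); split => /=.
  by apply: If; have := Rmax_l a M; lra.
by apply: HM; have := Rmax_r a M; lra.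
Qed.

Lemma is_RInt_gen_ext_Ici {V : NormedModule R_AbsRing} (f g : R -> V) (a : R) (l : V) :
  (forall t, a <= t -> f t = g t) ->
  is_RInt_gen f (at_point a) (Rbar_locally p_infty) l ->
  is_RInt_gen g (at_point a) (Rbar_locally p_infty) l.
Proof.
move=> fg; apply: is_RInt_gen_ext.
apply: (Filter_prod _ _ _ (fun x => x = a) (fun x => a < x)) => //.
  by exists a.
move=> x y -> ay t /=; rewrite Rmin_left; last lra.
by move=> ?; apply: fg; lra.
Qed.

Lemma is_RInt_gen_Ici_unique {V : CompleteNormedModule R_AbsRing} (f : R -> V)
    (a : R) (l1 l2 : V) :
  is_RInt_gen f (at_point a) (Rbar_locally p_infty) l1 ->
  is_RInt_gen f (at_point a) (Rbar_locally p_infty) l2 -> l1 = l2.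
Proof. by move=> I1 I2; rewrite -(is_RInt_gen_unique _ _ I1) (is_RInt_gen_unique _ _ I2). Qed.

Lemma norm_RInt_gen_le {V : CompleteNormedModule R_AbsRing} (f : R -> V) (g : R -> R)
    (a : R) (lf : V) (lg : R) :
  (forall t, a <= t -> norm (f t) <= g t) ->
  is_RInt_gen f (at_point a) (Rbar_locally p_infty) lf ->
  is_RInt_gen g (at_point a) (Rbar_locally p_infty) lg ->
  norm lf <= lg.
Proof.
move=> fg; apply: RInt_gen_norm.
  apply: (Filter_prod _ _ _ (fun x => x = a) (fun x => a < x)) => //.
    by exists a.
  by move=> x y -> ? /=; lra.
apply: (Filter_prod _ _ _ (fun x => x = a) (fun x => a < x)) => //.
  by exists a.
by move=> x y -> ? t /= ?; apply: fg; lra.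
Qed.

(** The increments of the partial integrals of [f] are bounded by those of [G],
    so they inherit the Cauchy criterion from the convergence of [G]. *)
Lemma ex_RInt_gen_dominated {V : CompleteNormedModule R_AbsRing}
    (f : R -> V) (g G : R -> R) (a lg : R) :
  (forall b, a <= b -> ex_RInt f a b) ->
  (forall b, a <= b -> is_RInt g a b (G b)) ->
  (forall t, a <= t -> norm (f t) <= g t) ->
  filterlim G (Rbar_locally p_infty) (locally lg) ->
  ex_RInt_gen f (at_point a) (Rbar_locally p_infty).
Proof.
move=> exf Ig fg limG.
have exG : exists y : R, filterlim G (Rbar_locally p_infty) (locally y).
  by exists lg.
have incr u v : a <= u -> u <= v ->
    norm (minus (RInt f a v) (RInt f a u)) <= G v - G u.
  move=> au uv.
  have exuv : ex_RInt f u v.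
    by apply: (ex_RInt_Chasles_2 _ a) (exf v _) => //; lra.
  have -> : minus (RInt f a v) (RInt f a u) = RInt f u v.
    rewrite -(RInt_Chasles f a u v (exf u au) exuv).
    by rewrite plus_comm /minus -plus_assoc plus_opp_r plus_zero_r.
  apply: (norm_RInt_le f g u v _ _ uv _ (RInt_correct _ _ _ exuv)).
    by move=> t ?; apply: fg; lra.
  have := is_RInt_Chasles g u a v _ _ (is_RInt_swap _ _ _ _ (Ig u au)) (Ig v _).
  have -> : G v - G u = plus (opp (G u)) (G v) by rewrite /plus /opp /=; ring.
  by apply; lra.
have /filterlim_locally_cauchy cG := exG.
have [l Hl] : exists l : V,
    filterlim (fun b => RInt f a b) (Rbar_locally p_infty) (locally l).
  apply/filterlim_locally_cauchy => eps.
  have [P [FP HP]] := cG eps.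
  exists (fun x => P x /\ a < x); split.
    by apply: filter_and => //; exists a.
  have le_case u v : P u -> a < u -> P v -> u <= v ->
      ball (RInt f a u) eps (RInt f a v).
    move=> Pu au Pv uv; apply: norm_compat1.
    apply: (Rle_lt_trans _ _ _ (incr u v _ uv)); first lra.
    have := HP u v Pu Pv.
    rewrite /ball /= /AbsRing_ball /abs /minus /plus /opp /=.
    by move=> /Rabs_def2 [? ?]; lra.
  move=> u v [Pu au] [Pv av]; case: (Rle_dec u v) => uv; first exact: le_case.
  by apply: ball_sym; apply: le_case => //; lra.
exists l; apply: is_RInt_gen_p_infty Hl => b ab.
by apply: RInt_correct; apply: exf.
Qed.

Lemma is_RInt_exp (c b : R) :
  0 < c -> is_RInt (fun t => exp (- c * t)) 0 b ((1 - exp (- c * b)) / c).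
Proof.
move=> c0.
have -> : (1 - exp (- c * b)) / c =
    minus (- exp (- c * b) / c) (- exp (- c * 0) / c).
  by rewrite /minus /plus /opp /= Rmult_0_r exp_0; field; lra.
apply: (is_RInt_derive (fun t => - exp (- c * t) / c)) => t _.
  by auto_derive => //; field; lra.
apply: (ex_derive_continuous (fun t => exp (- c * t))).
by auto_derive.
Qed.

Lemma lim_RInt_exp (c : R) :
  0 < c ->
  filterlim (fun b => (1 - exp (- c * b)) / c) (Rbar_locally p_infty) (locally (/ c)).
Proof.
move=> c0.
have expN : is_lim (fun b => exp (- c * b)) p_infty 0.
  apply: (is_lim_comp _ _ _ _ m_infty is_lim_exp_m); last first.
    by exists 0.
  apply: (is_lim_ext (fun b => - c * b)) => //.
  have -> : m_infty = Rbar_mult (Finite (- c)) p_infty.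
    by rewrite Rbar_mult_comm; symmetry; apply: is_Rbar_mult_unique; apply: is_Rbar_mult_p_infty_neg => /=; lra.
  by apply: is_lim_scal_l; apply: is_lim_id.
apply/filterlim_locally => eps.
have eps0 := cond_pos eps.
have ec : 0 < eps * c by apply: Rmult_lt_0_compat.
move/is_lim_spec: expN => /(_ (mkposreal _ ec)).
apply: filter_imp => b /=; rewrite Rminus_0_r => Hb.
change (Rabs ((1 - exp (- c * b)) / c - / c) < eps).
have -> : (1 - exp (- c * b)) / c - / c = - (exp (- c * b) / c) by field; lra.
rewrite Rabs_Ropp /Rdiv Rabs_mult (Rabs_pos_eq (/ c)); last first.
  by left; apply: Rinv_0_lt_compat.
by apply: (Rmult_lt_reg_r c) => //; rewrite Rmult_assoc Rinv_l; lra.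
Qed.

Lemma is_RInt_gen_exp (c : R) :
  0 < c ->
  is_RInt_gen (fun t => exp (- c * t)) (at_point 0) (Rbar_locally p_infty) (/ c).
Proof.
move=> c0; apply: is_RInt_gen_p_infty (lim_RInt_exp c c0) => b _.
exact: is_RInt_exp.
Qed.

(** * Orbits of a semigroup of exponential growth *)

(** [op_norm] is a supremum over the unit ball; homogeneity extends the bound
    to every vector. *)
Lemma norm_le_op_norm {V : CompleteNormedModule R_AbsRing} (A : V -> V) (B : R) (h : V) :
  is_linear A -> Rbar_le (op_norm A) B -> norm (A h) <= B * norm h.
Proof.
move=> linA leB.
have unit_le k : norm k <= 1 -> norm (A k) <= B.
  move=> k1; move: leB; rewrite /op_norm /Lub_Rbar; case: ex_lub_Rbar => l /= [ub _] lB.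
  have := ub (norm (A k)) (ex_intro _ k (conj k1 eq_refl)) => Al.
  exact: (Rbar_le_trans (norm (A k)) l B).
case: (Req_dec (norm h) 0) => [h0|h_neq0].
  by rewrite (norm_eq_zero h h0) (linear_zero _ linA) !norm_zero; lra.
have h_gt0 : 0 < norm h by have := norm_ge_0 h; lra.
have -> : A h = scal (norm h) (A (scal (/ norm h) h)).
  rewrite -(linear_scal _ linA) scal_assoc /mult /= Rinv_r //.
  by rewrite (scal_one h).
apply: (Rle_trans _ _ _ (norm_scal _ _)).
rewrite /abs /= Rabs_pos_eq; last lra.
rewrite (Rmult_comm B); apply: Rmult_le_compat_l; first lra.
apply: unit_le; apply: (Rle_trans _ _ _ (norm_scal _ _)).
rewrite /abs /= Rabs_pos_eq; last by left; apply: Rinv_0_lt_compat.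
by rewrite Rinv_l //; lra.
Qed.

Section Semigroup.

Context {V : CompleteNormedModule R_AbsRing} (K : R -> V -> V) (C omega : R).
Context (semiK : C0_semigroup K) (C_ge1 : 1 <= C) (omega_ge0 : 0 <= omega).
Context (growth : forall t h, 0 <= t -> norm (K t h) <= C * exp (omega * t) * norm h).

Lemma orbit_near0 (h : V) (eps : posreal) :
  exists delta : posreal, forall u, 0 <= u < delta -> norm (minus (K u h) h) < eps.
Proof.
have /filterlim_locally_ball_norm/(_ eps) [delta Hd] := C0_cont _ semiK h.
exists delta => // u [[u_gt0|<-] ud]; last first.
  by rewrite (C0_zero _ semiK) minus_eq_zero norm_zero; apply: cond_pos.
apply: Hd => //.
rewrite /ball /= /AbsRing_ball /abs /minus /plus /opp /= Ropp_0 Rplus_0_r.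
by rewrite Rabs_pos_eq; lra.
Qed.

(** By the semigroup law an increment of the orbit is [K a] applied to an
    increment at time [0]: right continuity at [0] thus gives continuity, from
    both sides, everywhere. *)
Lemma orbit_increment (a b : R) (h : V) :
  0 <= a <= b ->
  norm (minus (K b h) (K a h)) <= C * exp (omega * a) * norm (minus (K (b - a) h) h).
Proof.
move=> [a0 ab].
have {1}-> : b = a + (b - a) by ring.
have linKa := C0_linear _ semiK a a0.
rewrite (C0_plus _ semiK) //; last lra.
by rewrite -(linear_minus _ _ _ linKa); apply: growth.
Qed.

(** The truncation [Rmax 0 s] freezes the orbit at negative times, where
    [K] is arbitrary; the extension is then continuous on the whole line, as the
    integrability criterion for continuous functions requires at the endpoint [0]. *)
Lemma continuous_orbit (h : V) (t : R) : continuous (fun s => K (Rmax 0 s) h) t.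
Proof.
apply/filterlim_locally_ball_norm => eps.
(* [M] bounds the norm of [K a] for all times [a] within 1 of [t]. *)
pose M := C * exp (omega * (Rabs t + 1)).
have M0 : 0 < M by apply: Rmult_lt_0_compat (exp_pos _); lra.
have eM0 : 0 < eps / M by apply: Rdiv_lt_0_compat => //; apply: cond_pos.
have [delta Hd] := orbit_near0 h (mkposreal _ eM0).
have small a b : 0 <= a -> a <= Rabs t + 1 -> a <= b -> b - a < delta ->
    norm (minus (K b h) (K a h)) < eps.
  move=> a0 a1 ab bad.
  apply: (Rle_lt_trans _ (M * norm (minus (K (b - a) h) h))).
    apply: (Rle_trans _ _ _ (orbit_increment a b h (conj a0 ab))).
    apply: Rmult_le_compat_r (norm_ge_0 _) _.
    apply: Rmult_le_compat_l; first lra.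
    case: (Req_dec (omega * a) (omega * (Rabs t + 1))) => [->|neq]; first lra.
    have := Rmult_le_compat_l omega _ _ omega_ge0 a1.
    by move=> ?; left; apply: exp_increasing; lra.
  have := Hd (b - a) ltac:(lra); rewrite /= => lt_eM.
  apply: (Rmult_lt_reg_r (/ M)); first exact: Rinv_0_lt_compat.
  have -> : M * norm (minus (K (b - a) h) h) * / M = norm (minus (K (b - a) h) h).
    by field; lra.
  exact: lt_eM.
have d1 : 0 < Rmin delta 1 by apply: Rmin_pos; [apply: cond_pos | lra].
exists (mkposreal _ d1) => s.
rewrite /ball /= /AbsRing_ball /abs /minus /plus /opp /= => st.
have st1 : Rabs (s - t) < delta by have := Rmin_l delta 1; rewrite /Rminus; lra.
have st2 : Rabs (s - t) < 1 by have := Rmin_r delta 1; rewrite /Rminus; lra.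
move: st1 st2 => /Rabs_def2 [? ?] /Rabs_def2 [? ?].
have ? := Rle_abs t; have ? := Rabs_pos t.
rewrite /ball_norm.
have ? := Rmax_l 0 t; have ? := Rmax_l 0 s.
have ? : Rmax 0 s <= Rabs t + 1 by apply: Rmax_lub; lra.
have ? : Rmax 0 t <= Rabs t + 1 by apply: Rmax_lub; lra.
case: (Rle_dec (Rmax 0 t) (Rmax 0 s)) => le_ts.
  apply: small => //; move: le_ts.
  by rewrite /Rmax; do 2! case: Rle_dec => ? //; lra.
have -> : minus (K (Rmax 0 s) h) (K (Rmax 0 t) h) =
    opp (minus (K (Rmax 0 t) h) (K (Rmax 0 s) h)) by rewrite opp_minus.
rewrite norm_opp; apply: small => //; move: le_ts; first by lra.
by rewrite /Rmax; do 2! case: Rle_dec => ? //; lra.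
Qed.

(** * The Laplace transform of the semigroup *)

Definition laplace (lambda : R) (h : V) : V :=
  RInt_gen (fun t => scal (exp (- lambda * t)) (K t h))
           (at_point 0) (Rbar_locally p_infty).

Lemma continuous_weighted_orbit (lambda : R) (h : V) (t : R) :
  continuous (fun s => scal (exp (- lambda * s)) (K (Rmax 0 s) h)) t.
Proof.
apply: (continuous_scal (fun s => exp (- lambda * s))); last exact: continuous_orbit.
apply: (ex_derive_continuous (fun s => exp (- lambda * s))).
by auto_derive.
Qed.

Lemma ex_RInt_weighted_orbit (lambda b : R) (h : V) :
  0 <= b -> ex_RInt (fun t => scal (exp (- lambda * t)) (K t h)) 0 b.
Proof.
move=> b0; apply: (ex_RInt_ext (fun t => scal (exp (- lambda * t)) (K (Rmax 0 t) h))).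
  by move=> t; rewrite Rmin_left // => ?; rewrite Rmax_right //; lra.
by apply: ex_RInt_continuous => t _; apply: continuous_weighted_orbit.
Qed.

Lemma norm_weighted_orbit_le (lambda t : R) (h : V) :
  0 <= t ->
  norm (scal (exp (- lambda * t)) (K t h)) <= scal (C * norm h) (exp (- (lambda - omega) * t)).
Proof.
move=> t0; apply: (Rle_trans _ _ _ (norm_scal _ _)).
rewrite /abs /= Rabs_pos_eq; last by left; apply: exp_pos.
have -> : - (lambda - omega) * t = - lambda * t + omega * t by ring.
rewrite exp_plus /scal /= /mult /=.
have -> : C * norm h * (exp (- lambda * t) * exp (omega * t)) =
   exp (- lambda * t) * (C * exp (omega * t) * norm h) by ring.
apply: Rmult_le_compat_l; first by left; apply: exp_pos.
exact: growth.
Qed.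

Lemma ex_laplace (lambda : R) (h : V) :
  omega < lambda ->
  ex_RInt_gen (fun t => scal (exp (- lambda * t)) (K t h))
              (at_point 0) (Rbar_locally p_infty).
Proof.
move=> lt_l.
have c0 : 0 < lambda - omega by lra.
apply: (ex_RInt_gen_dominated _ _
  (fun b => scal (C * norm h) ((1 - exp (- (lambda - omega) * b)) / (lambda - omega)))
  0 (scal (C * norm h) (/ (lambda - omega)))).
- by move=> b; apply: ex_RInt_weighted_orbit.
- move=> b _; apply: is_RInt_scal; exact: is_RInt_exp.
- by move=> t; apply: norm_weighted_orbit_le.
- apply: filterlim_comp (lim_RInt_exp _ c0) _.
  exact: (filterlim_scal_r (V := R_NormedModule) (C * norm h)).
Qed.

Lemma is_laplace (lambda : R) (h : V) :
  omega < lambda ->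
  is_RInt_gen (fun t => scal (exp (- lambda * t)) (K t h))
              (at_point 0) (Rbar_locally p_infty) (laplace lambda h).
Proof. by move=> lt_l; exact: (RInt_gen_correct _ (ex_laplace lambda h lt_l)). Qed.

Lemma laplace_unique (lambda : R) (h l : V) :
  is_RInt_gen (fun t => scal (exp (- lambda * t)) (K t h))
              (at_point 0) (Rbar_locally p_infty) l ->
  laplace lambda h = l.
Proof. by move=> Il; exact: (is_RInt_gen_unique _ _ Il). Qed.

Lemma norm_laplace_le (lambda : R) (h : V) :
  omega < lambda -> norm (laplace lambda h) <= C / (lambda - omega) * norm h.
Proof.
move=> lt_l.
have c0 : 0 < lambda - omega by lra.
have -> : C / (lambda - omega) * norm h = scal (C * norm h) (/ (lambda - omega)).
  by rewrite /scal /= /mult /=; field; lra.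
apply: (norm_RInt_gen_le _ _ 0 _ _ _ (is_laplace lambda h lt_l)
          (is_RInt_gen_scal _ _ _ (is_RInt_gen_exp _ c0))) => t.
exact: norm_weighted_orbit_le.
Qed.

Lemma is_linear_laplace (lambda : R) : omega < lambda -> is_linear (laplace lambda).
Proof.
move=> lt_l; split.
- move=> g h; apply: laplace_unique.
  apply: is_RInt_gen_ext_Ici
    (is_RInt_gen_plus _ _ _ _ (is_laplace lambda g lt_l) (is_laplace lambda h lt_l)).
  by move=> t t0; rewrite (linear_plus _ (C0_linear _ semiK t t0)) scal_distr_l.
- move=> k h; apply: laplace_unique.
  apply: is_RInt_gen_ext_Ici (is_RInt_gen_scal _ k _ (is_laplace lambda h lt_l)).
  move=> t t0; rewrite (linear_scal _ (C0_linear _ semiK t t0)) !scal_assoc.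
  by rewrite /mult /= Rmult_comm.
- exists (C / (lambda - omega)); split; first by apply: Rdiv_lt_0_compat; lra.
  by move=> h; apply: norm_laplace_le.
Qed.

(** [K s] is bounded, so it can be moved under the integral, where it commutes
    with [K t] because addition of times is commutative. *)
Lemma laplace_comm (lambda s : R) (h : V) :
  omega < lambda -> 0 <= s -> K s (laplace lambda h) = laplace lambda (K s h).
Proof.
move=> lt_l s0; symmetry; apply: laplace_unique.
have linKs := C0_linear _ semiK s s0.
apply: is_RInt_gen_ext_Ici (is_RInt_gen_linear _ _ _ _ _ linKs (is_laplace lambda h lt_l)).
move=> t t0; rewrite (linear_scal _ linKs).
by rewrite -!(C0_plus _ semiK) // Rplus_comm.
Qed.

(** Under the integral [K s] shifts the orbit by [s]; in the variable [t + s] the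
    weight picks up the factor [exp (lambda * s)] and the domain loses [[0, s]]. *)
Lemma orbit_laplace (lambda s : R) (h : V) :
  omega < lambda -> 0 <= s ->
  K s (laplace lambda h) =
  scal (exp (lambda * s))
    (minus (laplace lambda h) (RInt (fun t => scal (exp (- lambda * t)) (K t h)) 0 s)).
Proof.
move=> lt_l s0.
have linKs := C0_linear _ semiK s s0.
set F := fun t => scal (exp (- lambda * t)) (K t h).
have Ks_lap : is_RInt_gen (fun t => K s (F t)) (at_point 0) (Rbar_locally p_infty)
    (K s (laplace lambda h)).
  exact: is_RInt_gen_linear linKs (is_laplace lambda h lt_l).
apply: is_RInt_gen_Ici_unique Ks_lap _.
have F0s : is_RInt_gen F (at_point s) (at_point 0) (opp (RInt F 0 s)).
  apply: is_RInt_gen_swap; apply/is_RInt_gen_at_point.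
  by apply: RInt_correct; apply: ex_RInt_weighted_orbit.
rewrite /minus plus_comm.
apply: is_RInt_gen_ext_Ici
  (is_RInt_gen_scal _ _ _ (is_RInt_gen_shift _ _ _
     (is_RInt_gen_Chasles _ _ _ _ F0s (is_laplace lambda h lt_l)))).
move=> t t0; rewrite /F (linear_scal _ linKs) scal_assoc -(C0_plus _ semiK) //.
rewrite (Rplus_comm s t) /mult /= -exp_plus.
by congr (scal (exp _) _); ring.
Qed.

(** * The Laplace transform is the resolvent *)

Lemma lim_exp_quotient (lambda : R) :
  filterlim (fun s => (exp (lambda * s) - 1) / s) (at_right 0) (locally lambda).
Proof.
have /is_derive_Reals D : is_derive (fun s => exp (lambda * s)) 0 lambda.
  by auto_derive => //; rewrite Rmult_0_r exp_0; ring.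
apply/filterlim_locally => eps.
have [delta Hd] := D eps (cond_pos eps).
exists delta => s s_near s_gt0.
have := Hd s ltac:(lra); rewrite Rplus_0_l Rmult_0_r exp_0; apply.
by move: s_near; rewrite /ball /= /AbsRing_ball /abs /minus /plus /opp /= Ropp_0 Rplus_0_r.
Qed.

(** The weighted orbit is continuous at [0] with value [h], so its means over
    [[0, s]] tend to [h]. *)
Lemma lim_mean_weighted_orbit (lambda : R) (h : V) :
  filterlim (fun s => scal (/ s) (RInt (fun t => scal (exp (- lambda * t)) (K t h)) 0 s))
    (at_right 0) (locally h).
Proof.
set F := fun t => scal (exp (- lambda * t)) (K t h).
apply/filterlim_locally_ball_norm => eps.
have eps0 := cond_pos eps.
have e20 : 0 < eps / 2 by lra.
have /filterlim_locally_ball_norm/(_ (mkposreal _ e20)) [delta Hd] :=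
  continuous_weighted_orbit lambda h 0.
have near0 t : 0 <= t < delta -> norm (minus (F t) h) <= eps / 2.
  move=> t0; left; have := Hd t.
  rewrite /ball_norm (Rmax_right 0 t); last lra.
  rewrite (Rmax_left 0 0); last lra.
  rewrite (C0_zero _ semiK) Rmult_0_r exp_0.
  have -> : scal 1 h = h by apply: scal_one.
  apply; rewrite /ball /= /AbsRing_ball /abs /minus /plus /opp /= Ropp_0 Rplus_0_r.
  by rewrite Rabs_pos_eq; lra.
exists delta => s s_near s_gt0.
have sd : s < delta.
  move: s_near; rewrite /ball /= /AbsRing_ball /abs /minus /plus /opp /= Ropp_0 Rplus_0_r.
  by rewrite Rabs_pos_eq; lra.
have s_ge0 : 0 <= s by lra.
have IF := RInt_correct _ _ _ (ex_RInt_weighted_orbit lambda s h s_ge0).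
have diff := is_RInt_minus _ _ _ _ _ _ IF (is_RInt_const 0 s h).
have := norm_RInt_le_const _ _ _ _ (eps / 2) s_ge0 _ diff.
rewrite Rminus_0_r => le_s.
have {}le_s : norm (minus (RInt F 0 s) (scal s h)) <= s * (eps / 2).
  by apply: le_s => t t_in; apply: near0; lra.
rewrite /ball_norm.
have {1}-> : h = scal (/ s) (scal s h).
  rewrite scal_assoc /mult /= Rinv_l; last lra.
  by symmetry; apply: scal_one.
rewrite -scal_minus_distr_l.
apply: (Rle_lt_trans _ _ _ (norm_scal _ _)).
have is_gt0 := Rinv_0_lt_compat s s_gt0.
rewrite /abs /= Rabs_pos_eq; last lra.
apply: (Rle_lt_trans _ (/ s * (s * (eps / 2)))).
  by apply: Rmult_le_compat_l => //; lra.
by rewrite -Rmult_assoc Rinv_l; lra.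
Qed.

(** By [orbit_laplace], with [J] for [laplace lambda h], the difference quotient of its orbit is
    [(exp (lambda * s) - 1) / s * J] minus [exp (lambda * s)] times the mean of the
    weighted orbit over [[0, s]]. *)
Lemma generator_laplace (lambda : R) (h : V) :
  omega < lambda ->
  is_generator_at K (laplace lambda h) (minus (scal lambda (laplace lambda h)) h).
Proof.
move=> lt_l; rewrite /is_generator_at.
set J := laplace lambda h.
set A := fun s => RInt (fun t => scal (exp (- lambda * t)) (K t h)) 0 s.
apply: (filterlim_ext_loc (fun s =>
    plus (scal ((exp (lambda * s) - 1) / s) J)
         (opp (scal (exp (lambda * s)) (scal (/ s) (A s)))))).
  exists (mkposreal 1 Rlt_0_1) => s _ s_gt0.
  rewrite /J orbit_laplace //; last lra.
  rewrite -/J -/(A s).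
  have -> : scal ((exp (lambda * s) - 1) / s) J =
      scal (/ s) (minus (scal (exp (lambda * s)) J) J).
    rewrite -{3}(scal_one J) -scal_minus_distr_r scal_assoc.
    by rewrite /Rdiv Rmult_comm.
  have -> : scal (exp (lambda * s)) (scal (/ s) (A s)) =
      scal (/ s) (scal (exp (lambda * s)) (A s)).
    by rewrite !scal_assoc /mult /= Rmult_comm.
  rewrite -scal_opp_r -scal_distr_l (scal_minus_distr_l (exp (lambda * s))) /minus -!plus_assoc.
  by rewrite (plus_comm (opp J)).
have exp_lim : filterlim (fun s => exp (lambda * s)) (at_right 0) (locally 1).
  have : continuous (fun s => exp (lambda * s)) 0.
    by apply: (ex_derive_continuous (fun s => exp (lambda * s))); auto_derive.
  rewrite /continuous Rmult_0_r exp_0 => ct P locP.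
  have := ct P locP; rewrite /filtermap /at_right /within.
  by apply: filter_imp.
have lim1 : filterlim (fun s => scal ((exp (lambda * s) - 1) / s) J) (at_right 0)
    (locally (scal lambda J)).
  exact: (filterlim_comp _ _ _ _ (fun c => scal c J) _ _ _ (lim_exp_quotient lambda) (filterlim_scal_l lambda J)).
have lim2 : filterlim (fun s => scal (exp (lambda * s)) (scal (/ s) (A s))) (at_right 0)
    (locally (scal 1 h)).
  exact: (filterlim_comp_2 _ _ scal exp_lim (lim_mean_weighted_orbit lambda h)
            (filterlim_scal 1 h)).
have {}lim2 := filterlim_comp _ _ _ _ _ _ _ _ lim2 (filterlim_opp _).
have -> : minus (scal lambda J) h = plus (scal lambda J) (opp (scal 1 h)).
  by congr (plus _ (opp _)); symmetry; apply: scal_one.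
exact: (filterlim_comp_2 _ _ plus lim1 lim2 (filterlim_plus _ _)).
Qed.

(** Both sides are limits of the difference quotients of the orbit of
    [laplace lambda h]: the right one by [generator_laplace], the left one because
    these quotients are the images under the transform of those of [h]. *)
Lemma laplace_generator (lambda : R) (h g : V) :
  omega < lambda -> is_generator_at K h g ->
  laplace lambda g = minus (scal lambda (laplace lambda h)) h.
Proof.
move=> lt_l gen_h.
have linJ := is_linear_laplace lambda lt_l.
apply: (filterlim_locally_unique (F := at_right 0) _ _ _ _ (generator_laplace lambda h lt_l)).
apply: (filterlim_ext_loc (fun s => laplace lambda (scal (/ s) (minus (K s h) h)))).
  exists (mkposreal 1 Rlt_0_1) => s _ s_gt0.
  rewrite (linear_scal _ linJ) (linear_minus _ _ _ linJ) laplace_comm //; lra.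
exact: filterlim_comp gen_h (linear_cont _ g linJ).
Qed.

Lemma generator_unique (h g : V) : is_generator_at K h g -> generator K h = g.
Proof.
move=> gen_h; apply: iota_unique => // y gen_y.
exact: (filterlim_locally_unique (F := at_right 0) _ _ _ gen_y gen_h).
Qed.

Lemma resolvent_laplace (lambda : R) (g : V) :
  omega < lambda -> resolvent K lambda g = laplace lambda g.
Proof.
move=> lt_l.
have linJ := is_linear_laplace lambda lt_l.
apply: iota_unique => [h [[k gen_h] <-]|].
  rewrite (generator_unique h k gen_h) (linear_minus _ _ _ linJ) (linear_scal _ linJ).
  rewrite (laplace_generator lambda h k lt_l gen_h).
  by rewrite minus_minus_cancel.
have gen_g := generator_laplace lambda g lt_l.
split; first by eexists; exact: gen_g.
rewrite (generator_unique _ _ gen_g).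
by rewrite minus_minus_cancel.
Qed.

Lemma laplace_in_resolvent_set (lambda : R) :
  omega < lambda -> in_resolvent_set K lambda.
Proof.
move=> lt_l.
have linJ := is_linear_laplace lambda lt_l.
have resE g := resolvent_laplace lambda g lt_l.
split; last split.
- by apply: (is_linear_ext (laplace lambda)) => // g; rewrite resE.
- move=> g; have gen_g := generator_laplace lambda g lt_l.
  rewrite resE (generator_unique _ _ gen_g); split; first by eexists; exact: gen_g.
  by rewrite minus_minus_cancel.
- move=> h [g gen_h]; rewrite resE (generator_unique _ _ gen_h).
  rewrite (linear_minus _ _ _ linJ) (linear_scal _ linJ).
  rewrite (laplace_generator lambda h g lt_l gen_h).
  by rewrite minus_minus_cancel.
Qed.

(** * Strong convergence *)

(** On the domain, [lambda ^ 2 * J h - lambda * h = lambda * (lambda * J h - h)] and the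
    bracket is [J (L h)]. *)
Lemma yosida_generator (lambda : R) (h g : V) :
  omega < lambda -> is_generator_at K h g ->
  yosida K lambda h = scal lambda (laplace lambda g).
Proof.
move=> lt_l gen_h.
rewrite /yosida resolvent_laplace // (laplace_generator lambda h g lt_l gen_h).
rewrite scal_minus_distr_l scal_assoc.
by congr (minus (scal _ _) _); rewrite /mult /=; ring.
Qed.

(** A single bound that is small near [0] and integrable against [exp (- lambda * t)]
    away from it.  For [t < delta], with [delta] given by continuity at [0], the
    displacement is at most [eps]; beyond it, [1 <= t / delta] and [t <= exp t - 1] turn
    the growth bound into a multiple of [exp ((omega + 1) * t) - exp (omega * t)], whose Laplace
    transform is explicit and of order [1 / lambda ^ 2]. *)
Lemma orbit_displacement_le (h : V) (eps : posreal) :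
  exists2 B : R, 0 <= B &
    forall t, 0 <= t ->
      norm (minus (K t h) h) <= eps + B * (exp ((omega + 1) * t) - exp (omega * t)).
Proof.
have eps0 := cond_pos eps.
have [delta Hd] := orbit_near0 h eps.
have d0 := cond_pos delta.
have nh := norm_ge_0 h.
have B0 : 0 <= (C + 1) * norm h / delta.
  by apply: Rdiv_le_0_compat => //; apply: Rmult_le_pos => //; lra.
exists ((C + 1) * norm h / delta) => // t t0.
have expt : exp ((omega + 1) * t) = exp (omega * t) * exp t.
  by rewrite -exp_plus; congr exp; ring.
have ewt := exp_pos (omega * t).
have ineq : t * exp (omega * t) <= exp ((omega + 1) * t) - exp (omega * t).
  have ? := exp_ineq1_le t.
  have := Rmult_le_compat_l (exp (omega * t)) (1 + t) (exp t) (Rlt_le _ _ ewt) ltac:(lra).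
  by rewrite expt; lra.
apply: (Rle_trans _ (eps + (C + 1) * norm h / delta * (t * exp (omega * t)))); last first.
  by apply: Rplus_le_compat_l; apply: Rmult_le_compat_l.
case: (Rlt_dec t delta) => td.
  have := Hd t (conj t0 td).
  have : 0 <= (C + 1) * norm h / delta * (t * exp (omega * t)).
    by apply: Rmult_le_pos => //; apply: Rmult_le_pos => //; lra.
  by lra.
have ewt1 : 1 <= exp (omega * t).
  have := exp_ineq1_le (omega * t).
  by have := Rmult_le_pos _ _ omega_ge0 t0; lra.
apply: (Rle_trans _ (norm (K t h) + norm h)).
  by have := norm_triangle (K t h) (opp h); rewrite norm_opp.
have := growth t h t0.
have : norm h <= exp (omega * t) * norm h.
  by rewrite -{1}(Rmult_1_l (norm h)); apply: Rmult_le_compat_r.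
have td1 : 1 <= t / delta.
  by apply: (Rmult_le_reg_r delta) => //; rewrite /Rdiv Rmult_assoc Rinv_l; lra.
have P0 : 0 <= (C + 1) * norm h * exp (omega * t).
  by apply: Rmult_le_pos; [apply: Rmult_le_pos; lra | lra].
have := Rmult_le_compat_l _ _ _ P0 td1.
have -> : (C + 1) * norm h / delta * (t * exp (omega * t)) =
    (C + 1) * norm h * exp (omega * t) * (t / delta) by field; lra.
by lra.
Qed.

(** As [lambda * exp (- lambda * t)] has integral [1] over the half-line, the
    difference is the integral of [lambda * exp (- lambda * t) * (K t h - h)], to which
    the bound of [orbit_displacement_le] applies. *)
Lemma norm_scal_laplace_minus_le (h : V) (eps : posreal) :
  exists2 B : R, 0 <= B &
    forall lambda, omega + 1 < lambda ->
      norm (minus (scal lambda (laplace lambda h)) h) <=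
      eps + B * (lambda * (/ (lambda - (omega + 1)) - / (lambda - omega))).
Proof.
have [B B0 HB] := orbit_displacement_le h eps.
exists B => // lambda lt_l.
have c0 : 0 < lambda by lra.
have c1 : 0 < lambda - (omega + 1) by lra.
have c2 : 0 < lambda - omega by lra.
have h_const : is_RInt_gen (fun t => scal (exp (- lambda * t)) h)
    (at_point 0) (Rbar_locally p_infty) (scal (/ lambda) h).
  exact: is_RInt_gen_linear (is_linear_scal_l h) (is_RInt_gen_exp lambda c0).
have lt_wl : omega < lambda by lra.
have If : is_RInt_gen
    (fun t => scal lambda (minus (scal (exp (- lambda * t)) (K t h)) (scal (exp (- lambda * t)) h)))
    (at_point 0) (Rbar_locally p_infty) (minus (scal lambda (laplace lambda h)) h).
  have -> : minus (scal lambda (laplace lambda h)) h =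
      scal lambda (minus (laplace lambda h) (scal (/ lambda) h)).
    rewrite scal_minus_distr_l scal_assoc /mult /= Rinv_r; last lra.
    by congr minus; symmetry; apply: scal_one.
  exact: (is_RInt_gen_scal _ lambda _
            (is_RInt_gen_minus _ _ _ _ (is_laplace lambda h lt_wl) h_const)).
have Ig : is_RInt_gen
    (fun t => lambda * (eps * exp (- lambda * t) +
       B * (exp (- (lambda - (omega + 1)) * t) - exp (- (lambda - omega) * t))))
    (at_point 0) (Rbar_locally p_infty)
    (eps + B * (lambda * (/ (lambda - (omega + 1)) - / (lambda - omega)))).
  have -> : eps + B * (lambda * (/ (lambda - (omega + 1)) - / (lambda - omega))) =
      lambda * (eps * / lambda + B * (/ (lambda - (omega + 1)) - / (lambda - omega))).
    by field; lra.
  exact: (is_RInt_gen_scal (V := R_NormedModule) _ lambda _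
    (is_RInt_gen_plus (V := R_NormedModule) _ _ _ _
      (is_RInt_gen_scal (V := R_NormedModule) _ eps _ (is_RInt_gen_exp lambda c0))
      (is_RInt_gen_scal (V := R_NormedModule) _ B _
        (is_RInt_gen_minus (V := R_NormedModule) _ _ _ _
           (is_RInt_gen_exp _ c1) (is_RInt_gen_exp _ c2))))).
apply: norm_RInt_gen_le If Ig => t t0.
apply: (Rle_trans _ _ _ (norm_scal _ _)).
rewrite /abs /= Rabs_pos_eq; last lra.
apply: Rmult_le_compat_l; first lra.
rewrite -scal_minus_distr_l.
apply: (Rle_trans _ _ _ (norm_scal _ _)).
have ewt := exp_pos (- lambda * t).
rewrite /abs /= Rabs_pos_eq; last lra.
have := Rmult_le_compat_l _ _ _ (Rlt_le _ _ ewt) (HB t t0).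
have -> : - (lambda - (omega + 1)) * t = - lambda * t + (omega + 1) * t by ring.
have -> : - (lambda - omega) * t = - lambda * t + omega * t by ring.
rewrite !exp_plus => le_t.
apply: (Rle_trans _ _ _ le_t); right; ring.
Qed.

Lemma lim_yosida (h : V) :
  generator_dom K h ->
  is_lim (fun lambda => norm (minus (yosida K lambda h) (generator K h))) p_infty 0.
Proof.
move=> [g gen_h]; rewrite (generator_unique h g gen_h).
apply/is_lim_spec => eps.
have eps0 := cond_pos eps.
have e20 : 0 < eps / 2 by lra.
have [B B0 HB] := norm_scal_laplace_minus_le g (mkposreal _ e20).
(* The first term gives [lambda <= 2 * (lambda - (omega + 1))], which bounds the
   error term [B * lambda / ((lambda - (omega + 1)) * (lambda - omega))] by
   [2 * B / (lambda - omega)]; the second makes this less than [eps / 2]. *)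
exists (2 * (omega + 1) + 4 * B / eps) => lambda lt_l.
have Be : 0 <= 4 * B / eps by apply: Rdiv_le_0_compat => //; lra.
rewrite (yosida_generator lambda h g) //; last lra.
rewrite Rminus_0_r Rabs_pos_eq; last exact: norm_ge_0.
apply: (Rle_lt_trans _ _ _ (HB lambda ltac:(lra))).
rewrite /=.
have c1 : 0 < lambda - (omega + 1) by lra.
have c2 : 0 < lambda - omega by lra.
have small : B * (lambda * (/ (lambda - (omega + 1)) - / (lambda - omega))) < eps / 2.
  have -> : B * (lambda * (/ (lambda - (omega + 1)) - / (lambda - omega))) =
      B * lambda / (lambda - (omega + 1)) / (lambda - omega) by field; lra.
  apply: (Rmult_lt_reg_r ((lambda - (omega + 1)) * (lambda - omega))).
    exact: Rmult_lt_0_compat.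
  have -> : B * lambda / (lambda - (omega + 1)) / (lambda - omega) *
      ((lambda - (omega + 1)) * (lambda - omega)) = B * lambda by field; lra.
  have Bl : 4 * B < eps * (lambda - omega).
    have := Rmult_lt_compat_l eps (4 * B / eps) (lambda - omega) eps0 ltac:(lra).
    by have -> : eps * (4 * B / eps) = 4 * B by field; lra.
  have := Rmult_le_compat_l (B) (lambda) (2 * (lambda - (omega + 1))) B0 ltac:(lra).
  have := Rmult_lt_compat_l (lambda - (omega + 1)) _ _ c1 Bl.
  by lra.
lra.
Qed.

End Semigroup.

Theorem mainTheorem2 (d : nat) (Omega : Rvec_space d -> Prop)
    (f : {x | Omega x} -> Rvec d)
    (phi : R -> {x | Omega x} -> {x | Omega x})
    (K : R -> Cb (Rvec_space d) Omega -> Cb (Rvec_space d) Omega)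
    (C omega : R)
    (Omega_precompact : precompact Omega)
    (f_lipschitz : locally_lipschitz f)
    (phi_flow : is_flow f phi)
    (K_koopman : is_koopman phi K)
    (K_semigroup : C0_semigroup K)
    (C_ge1 : 1 <= C) (omega_ge0 : 0 <= omega)
    (K_growth : forall t, 0 <= t -> Rbar_le (op_norm (K t)) (C * exp (omega * t))) :
  (forall lambda : R, omega < lambda ->
     in_resolvent_set K lambda /\
     forall h : Cb (Rvec_space d) Omega,
       ex_RInt_gen (fun t => scal (exp (- lambda * t)) (K t h))
                   (at_point 0) (Rbar_locally p_infty) /\
       yosida K lambda h =
         minus (scal (lambda ^ 2)
                  (RInt_gen (fun t => scal (exp (- lambda * t)) (K t h))
                            (at_point 0) (Rbar_locally p_infty)))
               (scal lambda h)) /\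
  (forall h : Cb (Rvec_space d) Omega, generator_dom K h ->
     is_lim (fun lambda => norm (minus (yosida K lambda h) (generator K h)))
            p_infty 0).
Proof.
have growth t h : 0 <= t -> norm (K t h) <= C * exp (omega * t) * norm h.
  move=> t0; apply: norm_le_op_norm; first exact: (C0_linear _ K_semigroup).
  exact: K_growth.
split => [lambda lt_l | h dom_h].
  split; first exact: (laplace_in_resolvent_set K C omega).
  move=> h; split; first exact: (ex_laplace K C omega).
  by rewrite /yosida (resolvent_laplace K C omega).
exact: (lim_yosida K C omega).
Qed.
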